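(* Let $f,h,g$ satisfy the standing assumptions (A1)–(A5) of the context and let $F$ be the associated function defined in the context. Suppose that $F$ has the KL property at $\tilde{\bm{x}}\in\mathrm{dom}\,\partial F$ with an exponent $\theta_F\in[0,1)$. Then, for any $\tau>1$, the function $\Phi_\tau(\bm{x},t):=F(\bm{x})+\frac{t^\tau}{\tau}$, $(\bm{x},t)\in\mathrm{dom}\,F\times\mathbb{R}_+$, has the KL property at $(\tilde{\bm{x}},0)$ with an exponent $\theta_\tau:=\max\left\{\theta_F,\frac{\tau-1}{\tau}\right\}$.
   Context: Setting. $\Omega:=\{\bm{x}\in\mathbb{R}^n: g(\bm{x})\neq0\}$ is nonempty, and $F(\bm{x}):=\frac{f(\bm{x})+h(\bm{x})}{g(\bm{x})}$ if $\bm{x}\in\mathrm{dom}\,f\cap\Omega$, $F(\bm{x}):=+\infty$ otherwise; $F$ is proper. Standing assumptions. (A1) $f:\mathbb{R}^n\to\mathbb{R}\cup\{+\infty\}$ is proper, closed and convex. (A2) $h:\mathbb{R}^n\to\mathbb{R}$ is continuously differentiable (possibly nonconvex) and there is $L_h>0$ with $\|\nabla h(\bm{x})-\nabla h(\bm{y})\|\le L_h\|\bm{x}-\bm{y}\|$ for all $\bm{x},\bm{y}$. (A3) $g:\mathbb{R}^n\to\mathbb{R}$ is continuous, convex, and nonnegative over $\mathrm{dom}\,f$. (A4) $f+h$ is nonnegative on $\mathrm{dom}\,f$, and $f(\bm{x})+h(\bm{x})>0$ when $g(\bm{x})=0$. (A5) $F$ is level-bounded: for every $\alpha\in\mathbb{R}$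 the set $\{\bm{x}:F(\bm{x})\le\alpha\}$ is bounded (possibly empty). Subdifferential. For a proper closed function $\psi$, $\partial\psi$ is the limiting subdifferential: $\widehat\partial\psi(\bm{x}):=\{\bm{d}:\liminf_{\bm{y}\to\bm{x},\bm{y}\ne\bm{x}}\frac{\psi(\bm{y})-\psi(\bm{x})-\langle\bm{d},\bm{y}-\bm{x}\rangle}{\|\bm{y}-\bm{x}\|}\ge0\}$, and $\partial\psi(\bm{x})$ is the set of limits of $\bm{d}^k\in\widehat\partial\psi(\bm{x}^k)$ with $\bm{x}^k\to\bm{x}$ and $\psi(\bm{x}^k)\to\psi(\bm{x})$. KL exponent. A proper closed function $\psi:\mathbb{R}^N\to\mathbb{R}\cup\{+\infty\}$ has the KL property at $\tilde{\bm{x}}\in\mathrm{dom}\,\partial\psi:=\{\bm{x}:\partial\psi(\bm{x})\ne\emptyset\}$ with an exponent $\theta\in[0,1)$ if there exist $a,\mu,\nu>0$ such that $\mathrm{dist}(0,\partial\psi(\bm{x}))\ge a(\psi(\bm{x})-\psi(\tilde{\bm{x}}))^\theta$ whenever $\bm{x}\in\mathrm{dom}\,\partial\psi$, $\|\bm{x}-\tilde{\bm{x}}\|\le\mu$ and $\psi(\tilde{\bm{x}})<\psi(\bm{x})<\psi(\tilde{\bm{x}})+\nu$. Here $\Phi_\tau$ is regarded as a function on $\mathbb{R}^{n}\times\mathbb{R}$ equal to $+\infty$ outside $\mathrm{dom}\,F\times\mathbb{R}_+$. *)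

(* Defs.v *)
From HB Require Import structures.
From mathcomp Require Import all_boot all_order all_algebra.
From mathcomp Require Import all_classical all_reals all_analysis.

Set Implicit Arguments.
Unset Strict Implicit.
Unset Printing Implicit Defensive.

Import Order.TTheory GRing.Theory Num.Theory.
Import numFieldNormedType.Exports.

Local Open Scope classical_set_scope.
Local Open Scope ring_scope.

Section Euclidean.
Context {R : realType} {n : nat}.
Implicit Types u v x : 'rV[R]_n.

Definition dotv u v : R := \sum_(i < n) u 0 i * v 0 i.

(* The library norm `|x| on row vectors is the sup norm; it induces the same
   topology and the same bounded sets, but not the same distances. *)
Definition enorm x : R := Num.sqrt (dotv x x).

(* Equal to +oo when A is empty. *)
Definition dist0 (A : set 'rV[R]_n) : \bar R :=
  ereal_inf [set (enorm d)%:E | d in A].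

Definition grad (h : 'rV[R]_n -> R) x : 'rV[R]_n :=
  \row_(i < n) 'D_(delta_mx 0 i) h x.

End Euclidean.

Section ExtendedRealFunctions.
Context {R : realType} {n : nat}.
Implicit Types (psi : 'rV[R]_n -> \bar R) (x y d : 'rV[R]_n).
Local Open Scope ereal_scope.

Definition edom psi : set 'rV[R]_n := [set x | psi x < +oo].

Definition eproper psi := edom psi !=set0 /\ forall x, psi x != -oo.

(* Intended for functions that never take the value -oo, so that oo - oo does
   not occur on the right; the endpoints t = 0, 1 are harmless as 0 * +oo = 0. *)
Definition econvex psi := forall x y (t : R), (0 <= t <= 1)%R ->
  psi (t *: x + (1 - t) *: y)%R <= t%:E * psi x + (1 - t)%:E * psi y.

Definition level_bounded psi :=
  forall alpha : R, bounded_set [set x | psi x <= alpha%:E].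

(* As usual, both subdifferentials are empty outside edom psi. *)
Definition frechet_subdiff psi x : set 'rV[R]_n :=
  [set d | edom psi x /\
    0 <= limf_einf
      (fun y => (psi y - psi x - (dotv d (y - x))%:E) * ((enorm (y - x))^-1)%:E)
      x^'].

Definition subdiff psi x : set 'rV[R]_n :=
  [set d | edom psi x /\
    exists xs ds : nat -> 'rV[R]_n,
      [/\ forall k, frechet_subdiff psi (xs k) (ds k),
          xs k @[k --> \oo] --> x,
          psi (xs k) @[k --> \oo] --> psi x
        & ds k @[k --> \oo] --> d]].

Definition dom_subdiff psi : set 'rV[R]_n := [set x | subdiff psi x !=set0].

Definition KL_exponent psi (xt : 'rV[R]_n) (theta : R) :=
  [/\ (0 <= theta < 1)%R, dom_subdiff psi xt &
   exists a mu nu : R, [/\ (0 < a)%R, (0 < mu)%R, (0 < nu)%R &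
     forall x, dom_subdiff psi x -> (enorm (x - xt) <= mu)%R ->
       psi xt < psi x -> psi x < psi xt + nu%:E ->
       (a * fine (psi x - psi xt) `^ theta)%:E <= dist0 (subdiff psi x)]].

End ExtendedRealFunctions.

Section FractionalProgram.
Context {R : realType} {n : nat}.
Local Open Scope ereal_scope.

Definition Fobj (f : 'rV[R]_n -> \bar R) (h g : 'rV[R]_n -> R)
    (x : 'rV[R]_n) : \bar R :=
  if (f x < +oo) && (g x != 0%R) then (f x + (h x)%:E) * ((g x)^-1)%:E
  else +oo.

(* A point (x, t) of R^n x R is encoded as z = row_mx x t : 'rV_(n + 1). *)
Definition Phi (tau : R) (F : 'rV[R]_n -> \bar R) (z : 'rV[R]_(n + 1))
    : \bar R :=
  let x := lsubmx z in let t := (rsubmx z 0 0)%R in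
  if (F x < +oo) && (0 <= t)%R then F x + (t `^ tau / tau)%:E else +oo.

End FractionalProgram.

(* Main.v *)
Require Import Defs.
From HB Require Import structures.
From mathcomp Require Import all_boot all_order all_algebra.
From mathcomp Require Import all_classical all_reals all_analysis.
From mathcomp Require Import lra.

Import Order.TTheory GRing.Theory Num.Theory.
Import numFieldNormedType.Exports.

Local Open Scope classical_set_scope.
Local Open Scope ring_scope.

(** Write [Phi] for [Phi tau F], so that [Phi (x, t) = F x + t ^ tau / tau] for
[t >= 0].  The variables are separated, and a limiting subgradient [(d, c)] of
[Phi] at [(x, t)] splits ([subdiff_Phi]): [d] is a limiting subgradient of [F]
at [x], and [t ^ (tau - 1) <= c] when [t > 0].  Hence [|(d, c)|] dominates both
[dist (0, subdiff F x)] and [t ^ (tau - 1)].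

Let [A = F x - F xt] and [B = t ^ tau / tau], so that
[Phi (x, t) - Phi (xt, 0) = A + B], and restrict to [A + B <= 1].  If [A >= B],
then [A > 0] and the KL inequality of [F] bounds [|(d, c)|] from below by
[a * A ^ theta].  If [B > A], then [t > 0] and [t ^ (tau - 1)], which is at least
[B ^ ((tau - 1) / tau)], is the lower bound.  As [A + B] is at most twice the
larger of [A] and [B] and is at most 1, either bound controls
[(A + B) ^ max (theta, (tau - 1) / tau)] up to the constant [min (a, 1) / 2]
([KL_sum_le]).  That [(xt, 0)] lies in the domain of the subdifferential of
[Phi] follows from [Phi (y, s) >= F y] with equality at [s = 0]
([subdiff_Phi_row_mx0]). *)

(** * Euclidean norm of block vectors *)

Section Euclid.
Context {R : realType} {n : nat}.
Implicit Types u v x : 'rV[R]_n.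

Lemma dotvv_ge0 x : 0 <= dotv x x.
Proof. by apply: sumr_ge0 => i _; rewrite -expr2 sqr_ge0. Qed.

Lemma enorm_gt0 x : x != 0 -> 0 < enorm x.
Proof.
move=> x0; rewrite sqrtr_gt0 lt0r dotvv_ge0 andbT.
apply: contra x0; rewrite psumr_eq0 => [/allP xx0|i _]; last first.
  by rewrite -expr2 sqr_ge0.
apply/eqP/rowP => i; rewrite mxE; apply/eqP.
by have := xx0 i (mem_index_enum i); rewrite /= mulf_eq0 orbb.
Qed.

Lemma dotv0 u : dotv u 0 = 0.
Proof. by rewrite /dotv big1// => i _; rewrite mxE mulr0. Qed.

Lemma enorm0 : enorm (0 : 'rV[R]_n) = 0.
Proof. by rewrite /enorm dotv0 sqrtr0. Qed.

Lemma dotv_row_mx u v (b c : 'rV[R]_1) :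
  dotv (row_mx u b) (row_mx v c) = dotv u v + b 0 0 * c 0 0.
Proof.
rewrite /dotv big_split_ord /= big_ord1 !row_mxEr.
by congr (_ + _); apply: eq_bigr => i _; rewrite !row_mxEl.
Qed.

Lemma enorm_row_mx0 x : enorm (row_mx x (0 : 'rV[R]_1)) = enorm x.
Proof. by rewrite /enorm dotv_row_mx mxE mulr0 addr0. Qed.

Lemma enorm_row_0mx (b : 'rV[R]_1) : enorm (row_mx (0 : 'rV[R]_n) b) = `|b 0 0|.
Proof. by rewrite /enorm dotv_row_mx dotv0 add0r -expr2 sqrtr_sqr. Qed.

Lemma enorm_lsubmx_le (z : 'rV[R]_(n + 1)) : enorm (lsubmx z) <= enorm z.
Proof.
rewrite -{2}[z]hsubmxK /enorm dotv_row_mx ler_wsqrtr// lerDl.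
by rewrite -expr2 sqr_ge0.
Qed.

Lemma norm_rsubmx_le (z : 'rV[R]_(n + 1)) : `|rsubmx z 0 0| <= enorm z.
Proof.
rewrite -{2}[z]hsubmxK /enorm dotv_row_mx -sqrtr_sqr ler_wsqrtr// -expr2 lerDr.
exact: dotvv_ge0.
Qed.

End Euclid.

(** * Frechet subgradients by epsilon-inequalities *)

Section Frechet.
Context {R : realType} {n : nat}.
Implicit Types (psi : 'rV[R]_n -> \bar R) (x y d : 'rV[R]_n).

Lemma diff_quotient_ge psi x y d (e : R) :
  psi y != -oo%E -> psi x \is a fin_num -> y != x ->
  ((- e)%:E <=
    (psi y - psi x - (dotv d (y - x))%:E) * ((enorm (y - x))^-1)%:E)%E =
  (psi x + (dotv d (y - x) - e * enorm (y - x))%:E <= psi y)%E.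
Proof.
move=> yN xf yx; have N0 : 0 < enorm (y - x) by rewrite enorm_gt0 ?subr_eq0.
case: (psi y) yN => [s| |] // _; rewrite -(fineK xf) -EFinD; last first.
  by rewrite !addye// gt0_mulye ?lte_fin ?invr_gt0// !leey.
by rewrite -!(EFinB, EFinD, EFinM) !lee_fin ler_pdivlMr//; apply/idP/idP; lra.
Qed.

(** The lower limit of the difference quotient is nonnegative exactly when every
affine minorant inequality with error [e * |y - x|] holds near [x]; the point
[y = x] may be included because the inequality is then an equality. *)
Lemma frechet_subdiffP psi x d : (forall y, psi y != -oo%E) ->
  frechet_subdiff psi x d <-> edom psi x /\ forall e : R, 0 < e ->
    \forall y \near x,
      (psi x + (dotv d (y - x) - e * enorm (y - x))%:E <= psi y)%E.
Proof.
move=> psiN; split=> -[xdom H]; split=> //.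
  have xf : psi x \is a fin_num by rewrite fin_numElt ltNye psiN.
  move=> e e0; move: H; rewrite limf_einfE => H.
  have /ereal_sup_gt[_ [V xV <-]] : ((- e)%:E < ereal_sup
      [set ereal_inf ((fun y => (psi y - psi x - (dotv d (y - x))%:E)
                                * ((enorm (y - x))^-1)%:E) @` V) | V in x^'])%E.
    by apply: lt_le_trans H; rewrite lte_fin oppr_lt0.
  move=> eV; rewrite /dnbhs /within /= in xV.
  near=> y; have [->|yx] := eqVneq y x.
    by rewrite subrr dotv0 enorm0 mulr0 subr0 adde0.
  rewrite -diff_quotient_ge//; apply: (le_trans (ltW eV)).
  by apply: ereal_inf_lbound; exists y => //; apply: (near xV y).
have xf : psi x \is a fin_num by rewrite fin_numElt ltNye psiN.
rewrite limf_einfE; apply/lee_addgt0Pr => e e0.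
rewrite -leeBlDr// sub0e.
apply: le_ereal_sup_tmp.
exists (ereal_inf
  [set (psi y - psi x - (dotv d (y - x))%:E) * ((enorm (y - x))^-1)%:E
  | y in [set y | y != x /\
      (psi x + (dotv d (y - x) - e * enorm (y - x))%:E <= psi y)%E]]%E).
  eexists; last reflexivity.
  by rewrite /dnbhs /within /=; near=> y => yx; split=> //; near: y; exact: H.
apply: le_ereal_inf_tmp => _ [y [yx yH] <-].
by rewrite diff_quotient_ge.
Unshelve. all: by end_near. Qed.

End Frechet.

(** * Convergence of block matrices *)

Lemma cvg_row_mx {R : realType} {m n p : nat} {T : Type} (F : set_system T)
    {FF : Filter F} (f : T -> 'M[R]_(m, n)) (g : T -> 'M[R]_(m, p))
    (a : 'M[R]_(m, n)) (b : 'M[R]_(m, p)) :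
  f @ F --> a -> g @ F --> b -> row_mx (f x) (g x) @[x --> F] --> row_mx a b.
Proof.
move=> /cvg_ballP fa /cvg_ballP gb; apply/cvg_ballP => e e0.
near=> x; split=> // i j.
have [_ fx] : ball a e (f x) by near: x; exact: fa.
have [_ gx] : ball b e (g x) by near: x; exact: gb.
by rewrite !mxE; case: (fintype.split j) => k; [exact: fx|exact: gx].
Unshelve. all: by end_near. Qed.

Lemma cvg_const_mx {R : realType} {m n : nat} {T : Type} (F : set_system T)
    {FF : Filter F} (f : T -> R) (a : R) :
  f @ F --> a -> (const_mx (f x) : 'M[R]_(m, n)) @[x --> F] -->
    (const_mx a : 'M[R]_(m, n)).
Proof.
move=> /cvg_ballP fa; apply/cvg_ballP => e e0.
by near=> x; split=> // i j; rewrite !mxE; near: x; exact: fa.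
Unshelve. all: by end_near. Qed.

Lemma cvg_lsubmx {R : realType} {n : nat} {T : Type} (F : set_system T)
    {FF : Filter F} (us : T -> 'rV[R]_(n + 1)) u (v : 'rV[R]_1) :
  us x @[x --> F] --> row_mx u v -> lsubmx (us x) @[x --> F] --> u.
Proof.
move=> usu; rewrite -[u](row_mxKl _ v).
by have := cvg_comp _ _ usu (@continuous_lsubmx R 1 n 1 (row_mx u v)).
Qed.

Lemma cvg_rsubmx {R : realType} {n : nat} {T : Type} (F : set_system T)
    {FF : Filter F} (us : T -> 'rV[R]_(n + 1)) (u : 'rV[R]_n) (v : 'rV[R]_1) :
  us x @[x --> F] --> row_mx u v -> rsubmx (us x) 0 0 @[x --> F] --> v 0 0.
Proof.
move=> usu; rewrite -[v](row_mxKr u).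
have usr := cvg_comp _ _ usu (@continuous_rsubmx R 1 n 1 (row_mx u v)).
by have := cvg_comp _ _ usr (@coord_continuous R 1 1 0 0 _).
Qed.

(** * Real powers *)

Lemma powR_continuous_gt0 {R : realType} (p t : R) : 0 < t ->
  {for t, continuous (fun s => s `^ p)}.
Proof.
move=> t0; apply: (@differentiable_continuous _ _ _ t (fun s => s `^ p)).
by apply/derivable1_diffP/derivable_powR; rewrite in_itv/= andbT.
Qed.

Lemma cvg_powR_gt0 {R : realType} {T : Type} (F : set_system T)
    {FF : Filter F} (f : T -> R) (t p : R) : 0 < t ->
  f x @[x --> F] --> t -> f x `^ p @[x --> F] --> t `^ p.
Proof.
move=> t0 ft.
by apply: (@continuous_cvg _ _ _ _ _ f (fun s => s `^ p) t) => //;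
  exact: powR_continuous_gt0.
Qed.

(** At [t = 0] the power is not continuous, as [s `^ p = 1] for [s < 0]; the sign
of [f] lets its powers be squeezed between [0] and [f]. *)
Lemma cvg_powR_nneg {R : realType} {T : Type} (F : set_system T)
    {FF : Filter F} (f : T -> R) (t p : R) :
  1 < p -> (forall x, 0 <= f x) -> 0 <= t ->
  f x @[x --> F] --> t -> f x `^ p @[x --> F] --> t `^ p.
Proof.
move=> p1 f0 t0 ft.
have [tp|t0'] := ltP 0 t.
  exact: cvg_powR_gt0.
have {t0 t0'} t0 : t = 0 by apply/eqP; rewrite eq_le t0 t0'.
rewrite t0 powR0 ?gt_eqF ?(lt_trans ltr01)//.
rewrite t0 in ft.
apply: (@squeeze_cvgr _ _ _ _ (fun=> 0) f) => //; last exact: cvg_cst.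
have fle1 : \forall x \near F, f x <= 1 by exact: (cvgr_le _ ft _ ltr01).
near=> x; rewrite powR_ge0/=.
have fx1 : f x <= 1 by near: x.
have := f0 x; rewrite le_eqVlt => /predU1P[<-|fx0].
  by rewrite powR0// gt_eqF// (lt_trans ltr01).
apply: ge1r_powR; last exact: ltW.
by rewrite fx0.
Unshelve. all: by end_near. Qed.

(** A one-dimensional Frechet subgradient of [t ^ p / p] at [t > 0] is at least
the derivative [t ^ (p - 1)]: only decrements [h < 0] are needed. *)
Lemma powR_slope_le {R : realType} (t p c : R) : 0 < t -> 0 < p ->
  (forall e : R, 0 < e -> \forall h \near 0,
     c * h - e * `|h| <= ((t + h) `^ p - t `^ p) / p) ->
  t `^ (p - 1) <= c.
Proof.
move=> t0 p0 H; apply/ler_addgt0Pr => e e0.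
have [dp Dp] := @is_derive1_powR R p t t0.
have /= q_cvg : h^-1 *: (((fun s => s `^ p) \o shift t) (h *: 1) - t `^ p) / p
    @[h --> 0^'-] --> t `^ (p - 1).
  rewrite -[X in _ --> X](mulKf (lt0r_neq0 p0)) [_ * (p * _)]mulrC.
  apply: cvgMl; rewrite -Dp.
  have sub : (0 : R)^'- `=>` 0^'.
    by apply: within_subset => h /=; rewrite lt_neqAle => /andP[].
  apply: cvg_trans dp.
  by apply: cvg_app; apply: sub.
apply: (ler_cvg_to q_cvg (cvg_cst (c + e))).
have He := H e e0.
near=> h.
have h0 : h < 0 by near: h; exact: nbhs_left_lt.
have : c * h - e * `|h| <= ((t + h) `^ p - t `^ p) / p.
  by near: h; exact: cvg_within He.
rewrite ltr0_norm// => Hh.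
rewrite [h%:A]mulr1 (addrC h t) [_ *: _]mulrC mulrAC.
rewrite ler_ndivrMr//; apply: le_trans Hh; lra.
Unshelve. all: by end_near. Qed.

(** * Subgradients of the function with an added power term *)

Section PhiSubdiff.
Context {R : realType} {n : nat} (tau : R) (F : 'rV[R]_n -> \bar R).
Hypotheses (tau_gt1 : 1 < tau) (F_ltNy : forall y, F y != -oo%E).
Implicit Types (x d : 'rV[R]_n) (b c : 'rV[R]_1) (z w : 'rV[R]_(n + 1)).

Let tau_gt0 : 0 < tau. Proof. exact: lt_trans tau_gt1. Qed.

Lemma Phi_row_mx x b : Phi tau F (row_mx x b) =
  if (F x < +oo)%E && (0 <= b 0 0)
  then (F x + (b 0 0 `^ tau / tau)%:E)%E else +oo%E.
Proof. by rewrite /Phi row_mxKl row_mxKr. Qed.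

Lemma edom_Phi x b : edom (Phi tau F) (row_mx x b) ->
  [/\ edom F x, 0 <= b 0 0 &
      Phi tau F (row_mx x b) = (F x + (b 0 0 `^ tau / tau)%:E)%E].
Proof. by rewrite /edom /= Phi_row_mx; case: ifP => [/andP[]|]; rewrite ?ltxx. Qed.

Lemma Phi_row_mx0 x : Phi tau F (row_mx x 0) = F x.
Proof.
rewrite Phi_row_mx mxE lexx andbT powR0 ?gt_eqF// mul0r adde0.
by case: ifPn => //; rewrite -leNgt leye_eq => /eqP.
Qed.

Lemma Phi_ltNy z : Phi tau F z != -oo%E.
Proof.
rewrite -[z]hsubmxK Phi_row_mx; case: ifP => // _.
by rewrite adde_eq_ninfty negb_or F_ltNy.
Qed.

Lemma Phi_ge z : (F (lsubmx z) <= Phi tau F z)%E.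
Proof.
rewrite -{2}[z]hsubmxK Phi_row_mx; case: ifP => _; last exact: leey.
by rewrite leeDl// lee_fin divr_ge0 ?powR_ge0// ltW.
Qed.

Lemma frechet_subdiff_Phi_l x d b c :
  frechet_subdiff (Phi tau F) (row_mx x b) (row_mx d c) -> frechet_subdiff F x d.
Proof.
move=> /(frechet_subdiffP _ _ _ Phi_ltNy)[/edom_Phi[xdom b0 PhiE] H].
apply/frechet_subdiffP => //; split=> // e e0.
have xf : F x \is a fin_num by rewrite fin_numElt ltNye F_ltNy.
have cvgx : row_mx y b @[y --> x] --> row_mx x b.
  apply: (@cvg_row_mx _ _ _ _ _ (nbhs x) _ id (fun=> b)).
    exact: cvg_id.
  exact: cvg_cst.
have {}H := cvgx _ (H e e0).
near=> y; have [yoo|ydom] := eqVneq (F y) +oo%E; first by rewrite yoo leey.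
have : (Phi tau F (row_mx x b) + (dotv (row_mx d c) (row_mx y b - row_mx x b)
    - e * enorm (row_mx y b - row_mx x b))%:E <= Phi tau F (row_mx y b))%E.
  by near: y.
rewrite PhiE opp_row_mx add_row_mx subrr enorm_row_mx0 dotv_row_mx mxE mulr0 addr0.
rewrite Phi_row_mx ltey ydom b0 /= addeAC leeD2rE//.
Unshelve. all: by end_near. Qed.

Lemma frechet_subdiff_Phi_r x d b c : 0 < b 0 0 ->
  frechet_subdiff (Phi tau F) (row_mx x b) (row_mx d c) ->
  b 0 0 `^ (tau - 1) <= c 0 0.
Proof.
move=> b_gt0 /(frechet_subdiffP _ _ _ Phi_ltNy)[/edom_Phi[xdom b0 PhiE] H].
have xf : F x \is a fin_num by rewrite fin_numElt ltNye F_ltNy.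
apply: powR_slope_le => // e e0.
have cvgh : row_mx x (const_mx (b 0 0 + h)) @[h --> 0] --> row_mx x b.
  apply: (@cvg_row_mx _ _ _ _ _ (nbhs (0 : R)) _ (fun=> x)).
    exact: cvg_cst.
  have -> : b = const_mx (b 0 0 + 0) by apply/rowP => i; rewrite mxE addr0 ord1.
  rewrite mxE addr0 -[X in const_mx X]addr0.
  by apply: cvg_const_mx; apply: cvgD; [exact: cvg_cst|exact: cvg_id].
have {}H := cvgh _ (H e e0).
have bh_ge0 : \forall h \near 0, 0 <= b 0 0 + h.
  have : b 0 0 + h @[h --> 0] --> b 0 0 + 0.
    by apply: cvgD => //; exact: cvg_cst.
  by rewrite addr0 => /cvgr_ge; apply.
near=> h.
have : (Phi tau F (row_mx x b) +
    (dotv (row_mx d c) (row_mx x (const_mx (b ord0 ord0 + h)%R) - row_mx x b)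
    - e * enorm (row_mx x (const_mx (b ord0 ord0 + h)%R) - row_mx x b))%:E
     <= Phi tau F (row_mx x (const_mx (b ord0 ord0 + h)%R)))%E.
  by near: h.
have bh0 : 0 <= b 0 0 + h by near: h.
rewrite PhiE opp_row_mx add_row_mx subrr enorm_row_0mx dotv_row_mx dotv0 add0r.
rewrite Phi_row_mx !mxE xdom bh0 /= -(fineK xf) -!EFinD lee_fin.
rewrite mulrBl [_ + h]addrC addrK; lra.
Unshelve. all: by end_near. Qed.

(** Since [Phi] dominates [F] and agrees with it at [t = 0]. *)
Lemma frechet_subdiff_Phi_row_mx0 x d : frechet_subdiff F x d ->
  frechet_subdiff (Phi tau F) (row_mx x 0) (row_mx d 0).
Proof.
move=> /(frechet_subdiffP _ _ _ F_ltNy)[xdom H].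
apply/(frechet_subdiffP _ _ _ Phi_ltNy); split.
  by rewrite /edom /= Phi_row_mx0.
move=> e e0.
have cvgl : lsubmx w @[w --> row_mx x (0 : 'rV[R]_1)] --> x.
  rewrite -[X in _ --> X](row_mxKl x (0 : 'rV[R]_1)).
  exact: continuous_lsubmx.
have {}H := cvgl _ (H e e0).
near=> w.
have Hw : (F x + (dotv d (lsubmx w - x) - e * enorm (lsubmx w - x))%:E
    <= F (lsubmx w))%E by near: w.
rewrite Phi_row_mx0; apply: le_trans (Phi_ge w); apply: le_trans Hw.
have wE : lsubmx w - x = lsubmx (w - row_mx x 0) by rewrite linearB /= row_mxKl.
rewrite wE -{1}[w - _]hsubmxK dotv_row_mx mxE mul0r addr0.
rewrite leeD2l// lee_fin lerD2l lerN2 ler_wpM2l ?(ltW e0)//.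
exact: enorm_lsubmx_le.
Unshelve. all: by end_near. Qed.

(** Both block properties of Frechet subgradients pass to the limit; in the
first one, [F (x_k)] converges because [Phi (x_k, t_k)] and [t_k ^ tau] do. *)
Lemma subdiff_Phi x d b c :
  subdiff (Phi tau F) (row_mx x b) (row_mx d c) ->
  subdiff F x d /\ (0 < b 0 0 -> b 0 0 `^ (tau - 1) <= c 0 0).
Proof.
move=> [/edom_Phi[xdom b0 PhiE] [zs [ws [frk cvgz cvgPhi cvgw]]]].
have {}frk k : frechet_subdiff (Phi tau F)
    (row_mx (lsubmx (zs k)) (rsubmx (zs k)))
    (row_mx (lsubmx (ws k)) (rsubmx (ws k))) by rewrite !hsubmxK.
have zdom k := edom_Phi _ _ (frk k).1.
split; last first.
  move=> b_gt0.
  have cvgpow : rsubmx (zs k) 0 0 `^ (tau - 1) @[k --> \oo] --> b 0 0 `^ (tau - 1).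
    by apply: cvg_powR_gt0 => //; exact: cvg_rsubmx cvgz.
  apply: (ler_cvg_to cvgpow (cvg_rsubmx _ _ _ _ cvgw)).
  have zs_gt0 : \forall k \near \oo, 0 < rsubmx (zs k) 0 0.
    exact: (cvgr_gt _ (cvg_rsubmx _ _ _ _ cvgz) _ b_gt0).
  near=> k; apply: frechet_subdiff_Phi_r (frk k); near: k; exact: zs_gt0.
split=> //; exists (fun k => lsubmx (zs k)), (fun k => lsubmx (ws k)); split.
- by move=> k; apply: frechet_subdiff_Phi_l (frk k).
- exact: cvg_lsubmx cvgz.
- have -> : (fun k => F (lsubmx (zs k))) =
      (fun k => Phi tau F (zs k) - (rsubmx (zs k) 0 0 `^ tau / tau)%:E)%E.
    apply/funext => k; have [_ _] := zdom k; rewrite hsubmxK => ->.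
    by rewrite addeK.
  have -> : F x = (Phi tau F (row_mx x b) - (b 0 0 `^ tau / tau)%:E)%E.
    by rewrite PhiE addeK.
  apply: cvgeB => //; first by rewrite fin_num_adde_defl.
  apply: cvg_EFin; first by near=> k.
  apply: cvgMl; apply: cvg_powR_nneg => //.
    by move=> k; have [] := zdom k.
  exact: cvg_rsubmx cvgz.
- exact: cvg_lsubmx cvgw.
Unshelve. all: by end_near. Qed.

Lemma subdiff_Phi_row_mx0 x d : subdiff F x d ->
  subdiff (Phi tau F) (row_mx x 0) (row_mx d 0).
Proof.
move=> [xdom [xs [ds [frk cvgx cvgF cvgd]]]].
split; first by rewrite /edom /= Phi_row_mx0.
exists (fun k => row_mx (xs k) 0), (fun k => row_mx (ds k) 0); split.
- by move=> k; apply: frechet_subdiff_Phi_row_mx0.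
- by apply: cvg_row_mx cvgx _; exact: cvg_cst.
- by rewrite Phi_row_mx0; under eq_fun do rewrite Phi_row_mx0.
- by apply: cvg_row_mx cvgd _; exact: cvg_cst.
Qed.

End PhiSubdiff.

(** * The Kurdyka-Lojasiewicz inequality *)

Lemma powR_le_double {R : realType} (s m p q : R) :
  0 < s <= 1 -> s <= 2 * m -> 0 <= p <= 1 -> p <= q -> s `^ q <= 2 * m `^ p.
Proof.
move=> /andP[s0 s1] sm /andP[p0 p1] pq.
have m0 : 0 <= m by lra.
apply: (@le_trans _ _ (s `^ p)); first by apply: ger_powR; rewrite ?s0.
apply: (@le_trans _ _ ((2 * m) `^ p)).
  by apply: ge0_ler_powR; rewrite // nnegrE; lra.
rewrite powRM//; apply: ler_wpM2r; first exact: powR_ge0.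
by apply: ler1_powR => //; lra.
Qed.

(** The scalar inequality behind the theorem, with [A] the increment of [F], [t]
the added variable, and [N] the norm of a subgradient.  The bounds on [N] are
needed only for [0 < A] and [0 < t], as the larger summand is positive. *)
Lemma KL_sum_le {R : realType} (a A t theta tau N : R) :
  0 < a -> 0 <= theta <= 1 -> 1 < tau -> 0 <= t ->
  0 < A + t `^ tau / tau <= 1 ->
  (0 < A -> a * A `^ theta <= N) -> (0 < t -> t `^ (tau - 1) <= N) ->
  Num.min a 1 / 2 * (A + t `^ tau / tau) `^ Num.max theta ((tau - 1) / tau) <= N.
Proof.
move=> a0 theta01 tau1 t0 S01 HA Ht.
have tau0 : 0 < tau by lra.
have tau_neq0 : tau != 0 by rewrite gt_eqF.
set B := t `^ tau / tau in S01 *; set S := A + B in S01 *.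
set eta := (tau - 1) / tau; set q := Num.max _ _.
have B0 : 0 <= B by rewrite divr_ge0 ?powR_ge0// ltW.
have min0 : 0 < Num.min a 1 by rewrite lt_min a0/=.
have half (u : R) : S `^ q <= 2 * u -> Num.min a 1 / 2 * S `^ q <= Num.min a 1 * u.
  move=> Su; rewrite -mulrA ler_pM2l// -[leRHS](mulKf (_ : 2 != 0))//.
  by rewrite ler_pM2l// invr_gt0.
have [AB|AB] := leP B A.
- have A0 : 0 < A by move: S01; rewrite /S; lra.
  apply: le_trans (HA A0); apply: le_trans (half (A `^ theta) _) _.
    by apply: powR_le_double => //; rewrite ?le_max ?lexx// /S; lra.
  by apply: ler_wpM2r; rewrite ?powR_ge0// ge_min lexx.
- have B_gt0 : 0 < B by move: S01; rewrite /S; lra.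
  have t_gt0 : 0 < t.
    rewrite lt_neqAle t0 andbT eq_sym; apply: contraTneq B_gt0 => t_eq0.
    by rewrite /B t_eq0 powR0// mul0r ltxx.
  have eta01 : 0 <= eta <= 1.
    by rewrite divr_ge0 ?subr_ge0 ?ler_pdivrMr//= ?ltW//; lra.
  apply: le_trans (Ht t_gt0); apply: le_trans (half (t `^ (tau - 1)) _) _.
    have -> : t `^ (tau - 1) = (t `^ tau) `^ eta.
      by rewrite -powRrM /eta mulrC divfK.
    have BT : B <= t `^ tau by rewrite ler_piMr ?powR_ge0// invf_le1// ltW.
    by apply: powR_le_double => //; rewrite ?le_max ?lexx ?orbT// /S; lra.
  by rewrite -[leRHS]mul1r; apply: ler_wpM2r; rewrite ?powR_ge0// ge_min lexx orbT.
Qed.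

(** The proposition for an arbitrary [F] that avoids the value [-oo]. *)
Lemma KL_exponent_Phi {R : realType} {n : nat} (F : 'rV[R]_n -> \bar R)
    (xt : 'rV[R]_n) (theta tau : R) : (forall x, F x != -oo%E) ->
  KL_exponent F xt theta -> 1 < tau ->
  KL_exponent (Phi tau F) (row_mx xt 0) (Num.max theta ((tau - 1) / tau)).
Proof.
move=> F_ltNy [/andP[theta0 theta1] [dt Fdt] [a [mu [nu [a0 mu0 nu0 FKL]]]]] tau1.
have tau0 : 0 < tau by lra.
have fin_edom y : edom F y -> F y \is a fin_num.
  by move=> ydom; rewrite fin_numElt ltNye F_ltNy.
have xtf : F xt \is a fin_num by apply: fin_edom; case: Fdt.
split.
- by rewrite le_max theta0/= gt_max theta1/= ltr_pdivrMr//; lra.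
- by exists (row_mx dt 0); exact: subdiff_Phi_row_mx0.
(* Capping nu by 1 makes powers of the increment decrease with the exponent. *)
exists (Num.min a 1 / 2), mu, (Num.min nu 1); split=> //.
- by rewrite divr_gt0// lt_min a0/=.
- by rewrite lt_min nu0/=.
move=> z [w zw]; rewrite -[z]hsubmxK in zw *.
set x := lsubmx z in zw *; set b := rsubmx z in zw *.
have [xdom b0 PhiE] := edom_Phi tau F x b zw.1.
have xf := fin_edom x xdom.
have [xdiff _] := subdiff_Phi tau F tau1 F_ltNy x (lsubmx w) b (rsubmx w)
  ltac:(by rewrite hsubmxK).
rewrite PhiE (Phi_row_mx0 tau F tau1) opp_row_mx add_row_mx subr0 => near_mu.
rewrite -(fineK xf) -(fineK xtf) -!EFinD !lte_fin => S_gt0 S_lt.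
have minnu1 : Num.min nu 1 <= 1 by rewrite ge_min lexx orbT.
have minnu : Num.min nu 1 <= nu by rewrite ge_min lexx.
have B0 : 0 <= b 0 0 `^ tau / tau by rewrite divr_ge0 ?powR_ge0// ltW.
apply: le_ereal_inf_tmp => _ [v zv <-]; rewrite lee_fin /=.
move: zv; rewrite -[v]hsubmxK => /(subdiff_Phi tau F tau1 F_ltNy)[vdiff vt].
rewrite addrAC; apply: KL_sum_le => //.
- by rewrite theta0 ltW.
- by lra.
- move=> A_gt0; rewrite -lee_fin.
  have near_x : enorm (x - xt) <= mu.
    apply: le_trans near_mu; apply: le_trans (enorm_lsubmx_le _).
    by rewrite row_mxKl.
  have := FKL x (ex_intro _ _ xdiff) near_x.
  rewrite -(fineK xf) -(fineK xtf) -EFinD !lte_fin => /(_ _ _)/le_trans; apply.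
  + by lra.
  + by lra.
  + apply: (@le_trans _ _ (enorm (lsubmx v))%:E).
      by apply: ereal_inf_lbound; exists (lsubmx v).
    by rewrite lee_fin hsubmxK enorm_lsubmx_le.
- move=> t0; apply: le_trans (vt t0) _; apply: le_trans (ler_norm _) _.
  by rewrite hsubmxK norm_rsubmx_le.
Qed.

Theorem proposition4p2 (R : realType) (n : nat)
  (f : 'rV[R]_n -> \bar R) (h g : 'rV[R]_n -> R)
  (Omega_neq0 : [set x | g x != 0] !=set0)
  (F_proper : eproper (Fobj f h g))
  (* (A1) *)
  (f_proper : eproper f) (f_closed : lower_semicontinuous f)
  (f_convex : econvex f)
  (* (A2) *)
  (h_diff : forall x, differentiable h x) (h_C1 : continuous (grad h))
  (h_lip : exists2 L : R, 0 < L &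
     forall x y, enorm (grad h x - grad h y) <= L * enorm (x - y))
  (* (A3) *)
  (g_cont : continuous g)
  (g_convex : convex_function [set: convex_lmodType 'rV[R]_n] g)
  (g_ge0 : forall x, edom f x -> 0 <= g x)
  (* (A4) *)
  (fh_ge0 : forall x, edom f x -> (0 <= f x + (h x)%:E)%E)
  (fh_gt0 : forall x, g x = 0 -> (0 < f x + (h x)%:E)%E)
  (* (A5) *)
  (F_level_bounded : level_bounded (Fobj f h g))
  (xt : 'rV[R]_n) (thetaF : R)
  (F_KL : KL_exponent (Fobj f h g) xt thetaF)
  (tau : R) (tau_gt1 : 1 < tau) :
  KL_exponent (Phi tau (Fobj f h g)) (row_mx xt 0)
    (Num.max thetaF ((tau - 1) / tau)).
Proof.
by apply: KL_exponent_Phi => //; case: F_proper.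
Qed.
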